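(* Let $\mathcal{A}$ be an $n$-dimensional perfect evolution algebra over a field $\mathbb{K}$ with natural basis $\{e_1,\dots,e_n\}$. For a triple $(f_1,f_2,f_3)$ of bijective linear maps on $\mathcal{A}$, write $f_1(e_i)=\sum_{k=1}^n c_{ki}e_k$, $f_2(e_i)=\sum_{k=1}^n a_{ki}e_k$ and $f_3(e_i)=\sum_{k=1}^n b_{ki}e_k$, with $c_{ki},a_{ki},b_{ki}\in\mathbb{K}$. Then $(f_1,f_2,f_3)$ is a ternary automorphism of $\mathcal{A}$ if and only if $$a_{ki}b_{kj}=0\quad\text{for all } i,j,k\in\{1,\dots,n\}\text{ with } i\neq j.$$ Moreover, $f_1$ is completely determined by $f_2$ and $f_3$.
   Context: $\mathbb{K}$ is an arbitrary field. An $n$-dimensional evolution algebra is an $n$-dimensional vector space $\mathcal{A}$ over $\mathbb{K}$ with a bilinear product admitting a basis $\{e_1,\dots,e_n\}$ (a natural basis) such that $e_ie_j=0$ for $i\neq j$; it is perfect if $\mathcal{A}^2=\mathcal{A}$. A ternary automorphism of $\mathcal{A}$ is a triple $(f_1,f_2,f_3)$ of bijective linear maps on $\mathcal{A}$ with $f_1(xy)=f_2(x)f_3(y)$ for all $x,y\in\mathcal{A}$.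
   Formalization: The condition does not involve f_1, so ''if'' fails for arbitrary f_1 (f_2=f_3=id, f_1=c·id, c≠0,1); it is stated as: for bijective f_2, f_3, some f_1 makes (f_1,f_2,f_3) a ternary automorphism iff a_{ki}b_{kj}=0 for all i≠j, and that f_1 is unique. *)

(* Defs.v *)
From mathcomp Require Import all_boot all_order all_algebra.

Set Implicit Arguments.
Unset Strict Implicit.
Unset Printing Implicit Defensive.

Import GRing.Theory.
Local Open Scope ring_scope.

Section EvolutionAlgebra.

Variables (K : fieldType) (A : vectType K).

(* The product is only assumed bilinear: evolution algebras are in general
   neither associative nor unital, so [falgType] does not apply. *)
Variable mul : {bilinear A -> A -> A}.

Definition natural_basis (n : nat) (e : n.-tuple A) : Prop :=
  basis_of fullv e /\ (forall i j : 'I_n, i != j -> mul e`_i e`_j = 0).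

(* A^2 is the linear span of all products; by bilinearity the scalars of a
   linear combination are absorbed into the factors, so that its elements are
   the finite sums of products. *)
Definition perfect : Prop :=
  forall x : A, exists s : seq (A * A), x = \sum_(p <- s) mul p.1 p.2.

Definition ternary_automorphism (f1 f2 f3 : 'End(A)) : Prop :=
  [/\ bijective f1, bijective f2, bijective f3
    & forall x y : A, f1 (mul x y) = mul (f2 x) (f3 y)].

End EvolutionAlgebra.

(* Main.v *)
Require Import Defs.
From mathcomp Require Import all_boot all_order all_algebra.
Import GRing.Theory.
Local Open Scope ring_scope.
Set Implicit Arguments.

(** In a natural basis the product is diagonal: the product of
    [\sum_i x_i e_i] and [\sum_i y_i e_i] is [\sum_i x_i y_i e_i^2].  Hence the
    [n] squares [e_i^2] span [A^2], and when [A] is perfect they form a basis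
    of [A] ([basis_squares]).

    Applying the diagonal formula to the columns of [a] and [b] gives
    [f2 e_i * f3 e_j = \sum_k a_ki b_kj e_k^2], so by independence of the
    squares the condition on the coefficients says exactly that
    [f2 e_i * f3 e_j = 0] whenever [i != j].  A ternary automorphism satisfies
    this, both sides being [f1 (e_i e_j) = f1 0].  Conversely, under this
    condition the only linear [f1] that can work sends the basis vector [e_i^2]
    to [f2 e_i * f3 e_i], and it does work by bilinearity
    ([morph_mul_natural]).  It is bijective without any computation: its image
    contains all the products [f2 x * f3 y], that is, all products since [f2]
    and [f3] are onto, and these span [A] ([bijective_morph_mul]).  Likewise a
    linear map is determined by its values on products ([eq_on_mul]), whence
    the uniqueness of [f1]. *)

Lemma bijective_lfun (K : fieldType) (V : vectType K) (f : 'End(V)) :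
  limg f = fullv -> bijective f.
Proof.
move=> fT; have kf : lker f == 0%VS.
  rewrite -dimv_eq0; have /eqP := limg_ker_dim f fullv.
  by rewrite capfv fT -[X in _ == X]add0n eqn_add2r.
by exists (f^-1)%VF; [apply: lker0_lfunK | apply: lker0_lfunVK].
Qed.

Section Perfect.

Variables (K : fieldType) (A : vectType K) (mul : {bilinear A -> A -> A}).
Hypothesis perfectA : perfect mul.

Lemma eq_on_mul (f g : 'End(A)) :
  (forall x y, f (mul x y) = g (mul x y)) -> f = g.
Proof.
move=> fg; apply/lfunP => x; have [s ->] := perfectA x.
by rewrite !linear_sum; apply: eq_bigr => p _; apply: fg.
Qed.

Lemma perfect_subv (U : {vspace A}) :
  (forall x y, mul x y \in U) -> U = fullv.
Proof.
move=> mulU; apply/vspaceP => x; rewrite memvf.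
by have [s ->] := perfectA x; apply: memv_suml => p _; apply: mulU.
Qed.

Lemma bijective_morph_mul (f1 f2 f3 : 'End(A)) :
    bijective f2 -> bijective f3 ->
    (forall x y, f1 (mul x y) = mul (f2 x) (f3 y)) ->
  bijective f1.
Proof.
move=> [g2 _ f2K] [g3 _ f3K] f1M; apply/bijective_lfun/perfect_subv => x y.
by rewrite -[x]f2K -[y]f3K -f1M memv_img ?memvf.
Qed.

End Perfect.

Section NaturalBasis.

Variables (K : fieldType) (A : vectType K) (mul : {bilinear A -> A -> A}).
Variables (n : nat) (e : n.-tuple A).
Hypothesis natural_e : natural_basis mul e.

Lemma mul_natural (x y : 'I_n -> K) :
  mul (\sum_i x i *: e`_i) (\sum_i y i *: e`_i)
    = \sum_i (x i * y i) *: mul e`_i e`_i.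
Proof.
have [_ e0] := natural_e.
rewrite linear_sumlz; apply: eq_bigr => i _.
rewrite linear_sumr (bigD1 i) //= big1 ?addr0 => [|j ji].
  by rewrite linearZl_LR linearZr_LR scalerA.
by rewrite linearZl_LR linearZr_LR e0 1?eq_sym // !scaler0.
Qed.

Lemma coord_natural (x : A) : x = \sum_i coord e i x *: e`_i.
Proof. by have [eB _] := natural_e; apply: coord_basis eB (memvf x). Qed.

Lemma mul_coord (x y : A) :
  mul x y = \sum_i (coord e i x * coord e i y) *: mul e`_i e`_i.
Proof. by rewrite {1}[x]coord_natural {1}[y]coord_natural mul_natural. Qed.

Definition squares : n.-tuple A := [tuple mul e`_i e`_i | i < n].

Lemma nth_squares (i : 'I_n) : squares`_i = mul e`_i e`_i.
Proof. by rewrite nth_mktuple. Qed.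

(** The squares span [A^2 = A], and there are only [\dim A] of them. *)
Lemma basis_squares : perfect mul -> basis_of fullv squares.
Proof.
move=> perfectA; have [eB _] := natural_e.
rewrite basisEdim size_tuple (size_basis eB) leqnn andbT.
suff -> : <<squares>>%VS = fullv by apply: subvv.
apply: (perfect_subv perfectA) => x y; rewrite mul_coord memv_suml // => i _.
by rewrite memvZ // -nth_squares memv_span // mem_nth // size_tuple.
Qed.

(** A bilinear identity need only be checked on pairs of basis vectors; the
    left-hand side vanishes on the pairs off the diagonal. *)
Lemma morph_mul_natural (f1 f2 f3 : 'End(A)) :
    (forall i : 'I_n, f1 (mul e`_i e`_i) = mul (f2 e`_i) (f3 e`_i)) ->
    (forall i j : 'I_n, i != j -> mul (f2 e`_i) (f3 e`_j) = 0) ->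
  forall x y, f1 (mul x y) = mul (f2 x) (f3 y).
Proof.
move=> f1sq f23 x y; rewrite mul_coord {2}[x]coord_natural {2}[y]coord_natural.
rewrite !(linear_sum f1, linear_sum f2, linear_sum f3) linear_sumlz.
apply: eq_bigr => i _.
rewrite linear_sumr (bigD1 i) //= big1 ?addr0 => [|j ji].
  by rewrite (linearZ_LR f1) (linearZ_LR f2) (linearZ_LR f3) /= f1sq linearZl_LR linearZr_LR scalerA.
by rewrite (linearZ_LR f2) (linearZ_LR f3) linearZl_LR linearZr_LR f23 1?eq_sym // !scaler0.
Qed.

(** The values of [f1] can be prescribed freely on the squares, since these
    are linearly independent. *)
Lemma exists_morph_mul (f2 f3 : 'End(A)) :
    perfect mul ->
    (forall i j : 'I_n, i != j -> mul (f2 e`_i) (f3 e`_j) = 0) ->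
  exists f1 : 'End(A), forall x y, f1 (mul x y) = mul (f2 x) (f3 y).
Proof.
move=> perfectA f23; have sqB := basis_squares perfectA.
have [f fE] := linear_of_free squares [tuple mul (f2 e`_i) (f3 e`_i) | i < n].
have {}fE := fE (basis_free sqB) (etrans (size_tuple _) (esym (size_tuple _))).
exists (linfun f); apply: morph_mul_natural => // i.
rewrite lfunE /= -nth_squares -(nth_map 0 0) ?size_tuple // fE.
by rewrite nth_mktuple.
Qed.

End NaturalBasis.

Unset Implicit Arguments.

Theorem lemma3p1 (K : fieldType) (n : nat) (A : vectType K)
    (mul : {bilinear A -> A -> A}) (e : n.-tuple A)
    (he : natural_basis mul e) (hperf : perfect mul)
    (f2 f3 : 'End(A)) (hf2 : bijective f2) (hf3 : bijective f3)
    (a b : 'M[K]_n)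
    (ha : forall i : 'I_n, f2 e`_i = \sum_(k < n) a k i *: e`_k)
    (hb : forall i : 'I_n, f3 e`_i = \sum_(k < n) b k i *: e`_k) :
  ((exists f1 : 'End(A), ternary_automorphism mul f1 f2 f3) <->
   (forall i j k : 'I_n, i != j -> a k i * b k j = 0))
  /\
  (forall f1 g1 : 'End(A),
     ternary_automorphism mul f1 f2 f3 -> ternary_automorphism mul g1 f2 f3 ->
     f1 = g1).
Proof.
have f23E (i j : 'I_n) :
    mul (f2 e`_i) (f3 e`_j) = \sum_k (a k i * b k j) *: mul e`_k e`_k.
  by rewrite ha hb (mul_natural he).
split; first split.
- move=> [f1 [_ _ _ f1M]] i j k ij; have [_ e0] := he.
  have /freeP sq_free := basis_free (basis_squares he hperf).
  apply: (sq_free (fun k => a k i * b k j)).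
  under eq_bigr do rewrite nth_squares.
  by rewrite -f23E -f1M e0 // linear0.
- move=> ab0; have [|f1 f1M] := exists_morph_mul he f2 f3 hperf.
    by move=> i j ij; rewrite f23E big1 // => k _; rewrite ab0 // scale0r.
  by exists f1; split=> //; apply: (bijective_morph_mul hperf _ _ _ hf2 hf3 f1M).
- move=> f1 g1 [_ _ _ f1M] [_ _ _ g1M]; apply: (eq_on_mul hperf _ _) => x y.
  by rewrite f1M g1M.
Qed.
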